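(* A real number $r$ is the asymptotic density of some d.c.e. set if and only if $r\in[0,1]$ and $r$ is a difference of two left-$\Pi^0_2$ reals (i.e. $r \in \mathcal{D}_2 \cap [0,1]$).
   Context: For $X \subseteq \omega=\{0,1,2,\dots\}$ and an integer $m>0$, let $\rho_m(X) = |\{j \in X : j < m\}|/m$. The set $X$ has a (asymptotic) density if $\lim_m \rho_m(X)$ exists, and the density is then $\rho(X) = \lim_m \rho_m(X)$. Saying that $r$ is the density of a set $X$ means that $X$ has a density and $\rho(X)=r$. A set is d.c.e. (equivalently, $2$-c.e.) if it is of the form $A\setminus B$ with $A,B\subseteq\omega$ computably enumerable. A real $r$ is left-$\Pi^0_2$ if its left Dedekind cut $\{q \in \mathbb{Q} : q < r\}$ is a $\Pi^0_2$ set. $\mathcal{D}_2$ is the set of all reals of the form $a-b$ where $a$ and $b$ are left-$\Pi^0_2$ reals. *)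

(* Defs.v *)
From mathcomp Require Import all_boot all_order all_algebra.
From mathcomp Require Import all_classical all_reals all_analysis.

Set Implicit Arguments.
Unset Strict Implicit.
Unset Printing Implicit Defensive.

Import Order.TTheory GRing.Theory Num.Theory.
Import numFieldNormedType.Exports.

Local Open Scope classical_set_scope.
Local Open Scope ring_scope.

(* Kleene's partial recursive functions. [PrimRec] recurses on, and [Mu]
   minimises over, the first argument. *)
Inductive murec : nat -> Type :=
| Zero n : murec n
| Succ : murec 1
| Proj n : 'I_n -> murec n
| Comp k n : murec k -> ('I_k -> murec n) -> murec n
| PrimRec n : murec n -> murec n.+2 -> murec n.+1
| Mu n : murec n.+1 -> murec n.

(* [murec_eval f x y]: f is defined at x, with value y. In the [PrimRec] case,
   h is the sequence of intermediate values; in the [Mu] case, f must be defined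
   and nonzero at all arguments below the value y. *)
Fixpoint murec_eval n (f : murec n) : n.-tuple nat -> nat -> Prop :=
  match f in murec n return n.-tuple nat -> nat -> Prop with
  | Zero _ => fun _ y => y = 0%N
  | Succ => fun x y => y = (thead x).+1
  | Proj _ i => fun x y => y = tnth x i
  | Comp k _ f g => fun x y =>
      exists z : k.-tuple nat, (forall i, murec_eval (g i) x (tnth z i)) /\
        murec_eval f z y
  | PrimRec _ f g => fun x y =>
      exists h : nat -> nat,
        [/\ murec_eval f [tuple of behead x] (h 0%N),
            forall i, (i < thead x)%N ->
              murec_eval g [tuple of i :: h i :: behead x] (h i.+1)
          & y = h (thead x)]
  | Mu _ f => fun x y =>
      murec_eval f [tuple of y :: x] 0%N /\
      forall i, (i < y)%N -> exists z, murec_eval f [tuple of i :: x] z.+1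
  end.

Definition ce (A : set nat) : Prop :=
  exists f : murec 1, forall x, A x <-> exists y, murec_eval f [tuple x] y.

Definition dce (X : set nat) : Prop :=
  exists A B : set nat, [/\ ce A, ce B & X = A `\` B].

Definition computable_rel n (D : set (n.-tuple nat)) : Prop :=
  exists f : murec n, forall x, murec_eval f x (nat_of_bool `[< D x >]).

Definition Pi02 n (P : set (n.-tuple nat)) : Prop :=
  exists2 D : set (n.+2.-tuple nat), computable_rel D &
    forall x, P x <-> forall y, exists z, D [tuple of y :: z :: x].

(* Every rational is denoted by some triple (a, b, c), read as (a - b) / (c + 1).
   A rational has many such codes, but equality of the denoted rationals is
   decidable, so this yields the usual arithmetical hierarchy on sets of
   rationals. *)
Definition rat_of_code (t : 3.-tuple nat) : rat :=
  ((tnth t 0)%:R - (tnth t 1)%:R) / (tnth t 2%:R).+1%:R.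

Definition Pi02_rat (S : set rat) : Prop := Pi02 (rat_of_code @^-1` S).

Definition left_Pi02 (R : realType) (a : R) : Prop :=
  Pi02_rat [set q : rat | ratr q < a].

Definition D2 (R : realType) : set R :=
  [set r | exists a b : R, [/\ left_Pi02 a, left_Pi02 b & r = a - b]].

(* The value of [rho X] at m = 0 is the junk value 0 / 0 = 0, which is
   irrelevant to the limit. *)
Definition rho (R : realType) (X : set nat) (m : nat) : R :=
  #|[pred j : 'I_m | `[< X (nat_of_ord j) >]]|%:R / m%:R.

Definition has_density (R : realType) (X : set nat) (r : R) : Prop :=
  rho R X m @[m --> \oo] --> r.

(* Main.v *)
(* If [A \ B] has density r, then rho(A) - rho(A & B) tends to r, so r is the
   difference of the upper densities of the c.e. sets A and A & B. The upper
   density L of a c.e. set is left-Pi02, since up to q = L the condition q < L says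
   that rho_m exceeds q for infinitely many m.
   Conversely let r = a - b < 1. Shift a and b by a common rational so that both lie
   in [0,1], and let v be a uniformly distributed computable sequence in [0,1). A Pi02
   description of the cut of a yields a c.e. set A that contains {v < a} and that is
   almost contained in {v < t} for every t > a; similarly for b. Then A \ B
   has density a - b. *)
Require Import Defs.
From mathcomp Require Import all_boot all_order all_algebra.
From mathcomp Require Import all_classical all_reals all_analysis.
From mathcomp Require Import zify ring lra.

Set Implicit Arguments.
Unset Strict Implicit.
Unset Printing Implicit Defensive.

(** * Computable functions of several variables *)

Lemma murec_eval_fun n (f : murec n) x y y' :
  murec_eval f x y -> murec_eval f x y' -> y = y'.
Proof.
elim: f x y y' => {n} /=.
- by move=> n x y y' -> ->.
- by move=> x y y' -> ->.
- by move=> n i x y y' -> ->.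
- move=> k n f IHf g IHg x y y' [z [gz fz]] [z' [gz' fz']].
  suff eqz : z = z' by apply: IHf fz _; rewrite eqz.
  by apply: eq_from_tnth => i; apply: IHg (gz i) (gz' i).
- move=> n f IHf g IHg x y y' [h [h0 hS ->]] [h' [h'0 h'S ->]].
  suff hh' i : (i <= thead x)%N -> h i = h' i by exact: hh'.
  elim: i => [|i IHi] lei; first exact: IHf h0 h'0.
  by apply: IHg (hS _ lei) _; rewrite IHi ?(ltnW lei)//; exact: h'S.
- move=> n f IHf x y y' [fy yP] [fy' y'P].
  have [lt|lt|//] := ltngtP y y'.
  + by have [z /(IHf _ _ _ fy)] := y'P _ lt.
  + by have [z /(IHf _ _ _ fy')] := yP _ lt.
Qed.

(* One function of sequences is computed at every arity, so no lengths have to be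
   tracked: variables beyond the arity read as the default value 0 of [nth]. *)
Definition computable (F : seq nat -> nat) : Prop :=
  forall n, exists c : murec n, forall x : n.-tuple nat, murec_eval c x (F x).

(** Simultaneous substitution. [Comp] takes a fixed number of inner functions, so the length of
    [G x] may depend only on the length of [x]. *)
Definition computable_env (G : seq nat -> seq nat) : Prop :=
  (forall n, exists m, forall x, size x = n -> size (G x) = m) /\
  forall i, computable (fun x => nth 0 (G x) i).

Lemma eq_computable F G : F =1 G -> computable F -> computable G.
Proof. by move=> FG cF n; have [c cP] := cF n; exists c => x; rewrite -FG. Qed.

Lemma computable_succ F : computable F -> computable (fun x => (F x).+1).
Proof.
move=> cF n; have [c cP] := cF n; exists (Comp Succ (fun _ => c)) => x /=.
by exists [tuple F x]; split=> // i; rewrite (tnth_nth 0) (ord1 i).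
Qed.

Lemma computable_const k : computable (fun _ => k).
Proof.
elim: k => [|k IHk]; last exact: computable_succ.
by move=> n; exists (Zero n).
Qed.

Lemma computable_nth i : computable (fun x => nth 0 x i).
Proof.
move=> n; case: (ltnP i n) => [lt|le].
  by exists (Proj (Ordinal lt)) => x /=; rewrite (tnth_nth 0).
by exists (Zero n) => x /=; rewrite nth_default// size_tuple.
Qed.

Lemma computable_subst F G :
  computable F -> computable_env G -> computable (fun x => F (G x)).
Proof.
move=> cF [sG cG] n; have [m mP] := sG n; have [c cP] := cF m.
have /choice[g gP] : forall i : 'I_m, exists c : murec n,
    forall x : n.-tuple nat, murec_eval c x (nth 0 (G x) i).
  by move=> i; apply: cG.
exists (Comp c g) => x /=; have sGx := mP _ (size_tuple x).
exists (Tuple (introT eqP sGx)); split=> [i|]; last exact: cP.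
by rewrite (tnth_nth 0); apply: gP.
Qed.

Lemma computable_env_cons F G :
  computable F -> computable_env G -> computable_env (fun x => F x :: G x).
Proof.
move=> cF [sG cG]; split=> [n|[|i]//=].
by have [m mP] := sG n; exists m.+1 => x /mP /= ->.
Qed.

Lemma computable_env_id : computable_env id.
Proof. by split=> [n|i]; [exists n | exact: computable_nth]. Qed.

Lemma computable_env_nil : computable_env (fun=> [::]).
Proof.
split=> [n|i]; first by exists 0.
by apply: eq_computable (computable_const 0) => x; rewrite nth_nil.
Qed.

Lemma computable_env_behead : computable_env behead.
Proof.
split=> [n|i]; first by exists n.-1 => x <-; rewrite size_behead.
by apply: eq_computable (computable_nth i.+1) => x; rewrite nth_behead.
Qed.

Lemma computable_rec b f g : computable b -> computable f -> computable g ->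
  computable (fun x =>
    nat_rect (fun=> nat) (f x) (fun i h => g (i :: h :: x)) (b x)).
Proof.
move=> cb cf cg n; have [c cP] := cb n; have [d dP] := cf n.
have [e eP] := cg n.+2.
(* [PrimRec] recurses on its first argument, so [Comp] puts [b x] in front of the unchanged
   parameters. *)
exists (Comp (PrimRec d e) (fun i => if unlift ord0 i is Some j then Proj j else c)).
move=> x /=; exists [tuple of b x :: x]; split.
  move=> i; case: unliftP => [j|] -> //=; rewrite (tnth_nth 0) /=.
  by rewrite (tnth_nth 0).
set R := nat_rect _ _ _; exists R.
have -> : [tuple of behead [tuple of b x :: x]] = x by apply: val_inj.
by split.
Qed.

Lemma computable_env_comp G H :
  computable_env G -> computable_env H -> computable_env (fun x => G (H x)).
Proof.
move=> [sG cG] cH; split=> [n|i]; last exact: computable_subst (cG i) cH.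
have [m mP] := cH.1 n; have [k kP] := sG m.
by exists k => x /mP /kP.
Qed.

Lemma computable_env_mkseq (F : nat -> seq nat -> nat) k :
  (forall i, computable (F i)) -> computable_env (fun x => mkseq (F^~ x) k).
Proof.
move=> cF; split=> [n|i]; first by exists k => x _; rewrite size_mkseq.
case: (ltnP i k) => [lt|le].
  by apply: eq_computable (cF i) => x; rewrite nth_mkseq.
by apply: eq_computable (computable_const 0) => x; rewrite nth_default ?size_mkseq.
Qed.

(** For lists built by cons over tails of the input, this leaves the computability of each entry. *)
Ltac solve_env :=
  repeat first [ exact: computable_env_nil | exact: computable_env_id
               | exact: computable_env_behead
               | apply: computable_env_cons
               | apply: (computable_env_comp computable_env_behead) ].

Lemma computable_add F G :
  computable F -> computable G -> computable (fun x => F x + G x).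
Proof.
move=> cF cG; have cS := computable_succ (computable_nth 1).
apply: eq_computable (computable_rec cG cF cS) => x /=.
by elim: (G x) => [|n /= ->]; rewrite ?addn0 ?addnS.
Qed.

Lemma computable_mul F G :
  computable F -> computable G -> computable (fun x => F x * G x).
Proof.
move=> cF cG; have cA : computable (fun x => nth 0 x 1 + F (behead (behead x))).
  apply: computable_add; first exact: computable_nth.
  by apply: computable_subst => //; solve_env.
apply: eq_computable (computable_rec cG (computable_const 0) cA) => x /=.
by elim: (G x) => [|n /= ->]; rewrite ?muln0 ?mulnS 1?addnC.
Qed.

Lemma computable_exp F G :
  computable F -> computable G -> computable (fun x => F x ^ G x).
Proof.
move=> cF cG; have cM : computable (fun x => F (behead (behead x)) * nth 0 x 1).
  apply: computable_mul; last exact: computable_nth.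
  by apply: computable_subst => //; solve_env.
apply: eq_computable (computable_rec cG (computable_const 1) cM) => x /=.
by elim: (G x) => [|n /= ->]; rewrite ?expnS.
Qed.

Lemma computable_pred F : computable F -> computable (fun x => (F x).-1).
Proof.
(* The recursion step returns the counter, whose last value is the predecessor. *)
move=> cF; have c0 := computable_nth 0.
apply: eq_computable (computable_rec cF (computable_const 0) c0) => x /=.
by case: (F x).
Qed.

Lemma computable_sub F G :
  computable F -> computable G -> computable (fun x => F x - G x).
Proof.
move=> cF cG; have cP := computable_pred (computable_nth 1).
apply: eq_computable (computable_rec cG cF cP) => x /=.
by elim: (G x) => [|n /= ->]; rewrite ?subn0 ?subnS.
Qed.

Lemma computable_sum F G : computable F -> computable G ->
  computable (fun x => \sum_(i < F x) G (val i :: x)).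
Proof.
move=> cF cG; have cA :
    computable (fun x => nth 0 x 1 + G (nth 0 x 0 :: behead (behead x))).
  apply: computable_add; first exact: computable_nth.
  apply: computable_subst => //; solve_env; exact: computable_nth.
apply: eq_computable (computable_rec cF (computable_const 0) cA) => x /=.
elim: (F x) => [|n /= ->]; first by rewrite big_ord0.
by rewrite big_ord_recr.
Qed.

(** * Decidable predicates *)

Definition decidable_on (P : seq nat -> bool) : Prop :=
  computable (fun x => P x : nat).

Lemma eq_decidable P Q : P =1 Q -> decidable_on P -> decidable_on Q.
Proof. by move=> PQ; apply: eq_computable => x; rewrite PQ. Qed.

Lemma decidable_subst P G :
  decidable_on P -> computable_env G -> decidable_on (fun x => P (G x)).
Proof. exact: computable_subst. Qed.

(** With truncated subtraction, [1 - (F x - G x)] is the truth value. *)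
Lemma decidable_leq F G :
  computable F -> computable G -> decidable_on (fun x => F x <= G x).
Proof.
move=> cF cG; have c1 := computable_const 1.
apply: eq_computable (computable_sub c1 (computable_sub cF cG)) => x.
by lia.
Qed.

Lemma decidable_neg P : decidable_on P -> decidable_on (fun x => ~~ P x).
Proof.
move=> cP; apply: eq_computable (computable_sub (computable_const 1) cP) => x.
by case: (P x).
Qed.

Lemma decidable_and P Q :
  decidable_on P -> decidable_on Q -> decidable_on (fun x => P x && Q x).
Proof.
by move=> cP cQ; apply: eq_computable (computable_mul cP cQ) => x; rewrite mulnb.
Qed.

Lemma decidable_imply P Q :
  decidable_on P -> decidable_on Q -> decidable_on (fun x => P x ==> Q x).
Proof.
move=> cP cQ; have cPQ := decidable_neg (decidable_and cP (decidable_neg cQ)).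
by apply: eq_decidable cPQ => x; case: (P x) (Q x) => -[].
Qed.

Lemma decidable_eq F G :
  computable F -> computable G -> decidable_on (fun x => F x == G x).
Proof.
move=> cF cG.
have cFG := decidable_and (decidable_leq cF cG) (decidable_leq cG cF).
by apply: eq_decidable cFG => x; rewrite eqn_leq.
Qed.

Lemma decidable_has F P : computable F -> decidable_on P ->
  decidable_on (fun x => has (fun i => P (i :: x)) (iota 0 (F x))).
Proof.
move=> cF cP.
(* An instance exists iff the sum of the truth values is at least 1. *)
have c0 := computable_succ (computable_const 0).
have cS := decidable_leq c0 (computable_sum cF cP).
apply: eq_decidable cS => x; elim: (F x) => [|n IHn]; first by rewrite big_ord0.
rewrite big_ord_recr -[in iota _ _]addn1 iotaD has_cat -IHn /= orbF.
by case: (P _); rewrite ?addn0 ?orbF ?addn1 ?orbT.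
Qed.

Lemma decidable_all F P : computable F -> decidable_on P ->
  decidable_on (fun x => all (fun i => P (i :: x)) (iota 0 (F x))).
Proof.
move=> cF cP; have cN := decidable_neg (decidable_has cF (decidable_neg cP)).
by apply: eq_decidable cN => x; rewrite -all_predC;
  apply: eq_all => i /=; rewrite negbK.
Qed.

(** * Division and the coding of finite sequences *)

Lemma sum_nat_ltn k n : \sum_(i < n) (i < k) = minn n k.
Proof. by elim: n => [|n IHn]; rewrite ?big_ord0 ?min0n// big_ord_recr/= IHn; lia. Qed.

(** The quotient counts the [i < F x] with [i.+1 * G x <= F x]; the factor [1 <= G x] produces the
    value 0 of a division by 0. *)
Lemma computable_div F G :
  computable F -> computable G -> computable (fun x => F x %/ G x).
Proof.
move=> cF cG.
have cL : decidable_on (fun y => (nth 0 y 0).+1 * G (behead y) <= F (behead y)).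
  apply: decidable_leq; last by apply: computable_subst => //; solve_env.
  apply: computable_mul; first exact: computable_succ (computable_nth 0).
  by apply: computable_subst => //; solve_env.
have c0 := decidable_leq (computable_const 1) cG.
have cM := computable_mul c0 (computable_sum cF cL).
apply: eq_computable cM => x /=.
case: (posnP (G x)) => [->|G0]; first by rewrite divn0.
rewrite mul1n -[RHS](minn_idPr (leq_div _ (G x))) -sum_nat_ltn.
by apply: eq_bigr => i _; rewrite leq_divRL.
Qed.

(** Digit [i] of [c] in base [b]. The pair [b], [c] codes a finite sequence, in the role of Goedel's
    beta function. *)
Definition digit (b c i : nat) : nat := (c %/ b ^ i) %% b.

Lemma computable_digit B C I : computable B -> computable C -> computable I ->
  computable (fun x => digit (B x) (C x) (I x)).
Proof.
move=> cB cC cI; have cD := computable_div cC (computable_exp cB cI).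
have cM := computable_mul (computable_div cD cB) cB.
apply: eq_computable (computable_sub cD cM) => x.
by rewrite /digit {1}(divn_eq (_ %/ _) (B x)) addKn.
Qed.

(** Any positive base above all the values will do; [c] is then built by Horner's rule, with [h 0]
    as lowest digit. *)
Lemma digit_ex (h : nat -> nat) n :
  exists b c, forall i, i < n -> digit b c i = h i.
Proof.
suff H b : 0 < b -> (forall i, i < n -> h i < b) ->
    exists c, forall i, i < n -> digit b c i = h i.
  exists (\max_(i < n) h i).+1; apply: H => // i lt.
  by rewrite ltnS (leq_bigmax (Ordinal lt)).
move=> b0; elim: n h => [|n IHn] h hb; first by exists 0.
have [i lt|c cP] := IHn (fun i => h i.+1); first exact: hb.
exists (h 0 + c * b) => -[|i] lt; rewrite /digit.
  by rewrite divn1 addnC modnMDl modn_small ?hb.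
rewrite expnS divnMA addnC divnMDl// (divn_small (hb 0 _))// addn0.
exact: cP.
Qed.

(** * Semidecidable predicates and Kleene normal form *)

(** The $\Sigma^0_1$ predicates, with one unbounded witness in front; [ce_semidecidable] and
    [Pi02_semidecidable] relate them to [ce] and [Pi02]. *)
Definition semidecidable (P : seq nat -> Prop) : Prop :=
  exists2 F : seq nat -> bool, decidable_on F &
    forall x, P x <-> exists s, F (s :: x).

Lemma eq_semidecidable P Q :
  (forall x, P x <-> Q x) -> semidecidable P -> semidecidable Q.
Proof.
by move=> PQ [F dF FP]; exists F => // x; rewrite -PQ.
Qed.

Lemma semidecidable_dec (P : seq nat -> bool) :
  decidable_on P -> semidecidable P.
Proof.
move=> dP; exists (fun x => P (behead x)).
  by apply: decidable_subst => //; solve_env.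
by move=> x; split=> [Px|[]//]; exists 0.
Qed.

(** Searching for a witness up to [s], instead of testing [s] alone, makes the matrix monotone, so
    that several witnesses can be replaced by their maximum. *)
Lemma semidecidable_mono P : semidecidable P -> exists F : seq nat -> bool,
  [/\ decidable_on F, forall x, P x <-> exists s, F (s :: x) &
      forall s t x, s <= t -> F (s :: x) -> F (t :: x)].
Proof.
move=> [F dF FP].
exists (fun w => has (fun i => F (i :: behead w)) (iota 0 (nth 0 w 0).+1)); split.
- have dF' : decidable_on (fun v => F (nth 0 v 0 :: behead (behead v))).
    by apply: decidable_subst => //; solve_env; exact: computable_nth.
  exact: decidable_has (computable_succ (computable_nth 0)) dF'.
- move=> x; rewrite FP; split=> [[s Fs]|[s /hasP[i _ Fi]]]; last by exists i.
  by exists s; apply/hasP; exists s => //; rewrite mem_iota /= add0n ltnSn.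
- move=> s t x lst /hasP[i]; rewrite mem_iota add0n => lti Fi.
  by apply/hasP; exists i => //; rewrite mem_iota /= add0n; apply: leq_trans lti _.
Qed.

Lemma semidecidable_subst P G :
  semidecidable P -> computable_env G -> semidecidable (fun x => P (G x)).
Proof.
move=> [F dF FP] cG; exists (fun w => F (nth 0 w 0 :: G (behead w))).
  apply: decidable_subst => //; apply: computable_env_cons.
    exact: computable_nth.
  exact: computable_env_comp cG computable_env_behead.
by move=> x; rewrite FP.
Qed.

Lemma semidecidable_and P Q :
  semidecidable P -> semidecidable Q -> semidecidable (fun x => P x /\ Q x).
Proof.
move=> /semidecidable_mono[F [dF FP Fm]] /semidecidable_mono[G [dG GP Gm]].
exists (fun w => F w && G w); first exact: decidable_and.
move=> x; rewrite FP GP; split=> [[[s Fs] [t Gt]]|[s /andP[Fs Gs]]].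
  exists (maxn s t); rewrite (Fm _ _ _ (leq_maxl s t))//.
  by rewrite (Gm _ _ _ (leq_maxr s t)).
by split; exists s.
Qed.

Lemma semidecidable_imply (P : seq nat -> bool) Q :
  decidable_on P -> semidecidable Q -> semidecidable (fun x => P x -> Q x).
Proof.
move=> dP [F dF FP]; exists (fun w => P (behead w) ==> F w).
  apply: decidable_imply => //.
  by apply: decidable_subst => //; solve_env.
move=> x; rewrite FP /=; case: (P x) => /=; last by split=> // _; exists 0.
by split=> [/(_ isT)[s Fs]|[s Fs] _]; exists s.
Qed.

Lemma semidecidable_ex P :
  semidecidable P -> semidecidable (fun x => exists i, P (i :: x)).
Proof.
move=> /semidecidable_mono[F [dF FP Fm]].
(* One number bounds both [i] and its witness; [F'] swaps the two, as [v] is [i :: s :: x]. *)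
pose F' v := F (nth 0 v 1 :: nth 0 v 0 :: behead (behead v)).
exists (fun w => has (fun i => F' (i :: w)) (iota 0 (nth 0 w 0).+1)).
  apply: decidable_has; first exact: computable_succ (computable_nth 0).
  by apply: decidable_subst => //; solve_env; exact: computable_nth.
move=> x; split=> [[i /FP[s Fs]]|[s /hasP[i _ Fi]]]; last first.
  by exists i; rewrite FP; exists s.
exists (maxn i s); apply/hasP; exists i.
  by rewrite mem_iota /= add0n ltnS leq_maxl.
by apply: Fm Fs; exact: leq_maxr.
Qed.

(** By monotonicity, finitely many instances have a common witness. *)
Lemma semidecidable_all_lt b P : computable b -> semidecidable P ->
  semidecidable (fun x => forall i, i < b x -> P (i :: x)).
Proof.
move=> cb /semidecidable_mono[F [dF FP Fm]].
pose F' v := F (nth 0 v 1 :: nth 0 v 0 :: behead (behead v)).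
exists (fun w => all (fun i => F' (i :: w)) (iota 0 (b (behead w)))).
  apply: decidable_all.
    by apply: computable_subst => //; solve_env.
  by apply: decidable_subst => //; solve_env; exact: computable_nth.
move=> x /=; split=> [|[s /allP Fs] i lti]; last first.
  by rewrite FP; exists s; apply: Fs; rewrite mem_iota.
elim: (b x) => [|k IHk] Pk; first by exists 0.
have [i lti|s Fs] := IHk; first exact/Pk/ltnW.
have [t Ft] := (FP _).1 (Pk k (ltnSn k)).
exists (maxn s t); apply/allP => i; rewrite mem_iota /= add0n ltnS leq_eqVlt.
case/orP=> [/eqP ->|lti]; first by apply: Fm Ft; exact: leq_maxr.
have /allP/(_ i) := Fs; rewrite mem_iota /= add0n => /(_ lti).
by apply: Fm; exact: leq_maxl.
Qed.

(** Meant for a fixed number of different predicates, such as the graphs of the inner functions of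
    [Comp]. *)
Lemma semidecidable_all_ord k (P : 'I_k -> seq nat -> Prop) :
  (forall i, semidecidable (P i)) -> semidecidable (fun x => forall i, P i x).
Proof.
elim: k P => [|k IHk] P sP.
  have dT := decidable_leq (computable_const 0) (computable_const 0).
  by apply: eq_semidecidable (semidecidable_dec dT) => x; split=> // _ [].
have sS := IHk _ (fun i => sP (lift ord0 i)).
apply: eq_semidecidable (semidecidable_and (sP ord0) sS) => x.
 split=> [[P0 PS] i|Px]; last by split.
by case: (unliftP ord0 i) => [j|] ->.
Qed.

(** * Graphs of recursive functions *)

Definition tuple_nth n (w : seq nat) : n.-tuple nat := [tuple nth 0 w i | i < n].

Lemma nth_tuple_nth n w i : i < n -> nth 0 (tuple_nth n w) i = nth 0 w i.
Proof. by move=> lti; rewrite -(tnth_nth 0 _ (Ordinal lti)) tnth_mktuple. Qed.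

Lemma tuple_nth_behead n w :
  [tuple of behead (tuple_nth n.+1 w)] = tuple_nth n (behead w).
Proof.
apply: eq_from_tnth => i; rewrite tnth_mktuple (tnth_nth 0) [LHS]nth_behead.
by rewrite nth_tuple_nth ?nth_behead// ltnS.
Qed.

Lemma tuple_nth_cons n a w :
  [tuple of a :: tuple_nth n w] = tuple_nth n.+1 (a :: w).
Proof.
apply: eq_from_tnth => i; rewrite tnth_mktuple.
by case: (unliftP ord0 i) => [j|] ->; rewrite ?tnthS ?tnth_mktuple.
Qed.

Lemma tuple_nthK n (x : n.-tuple nat) : tuple_nth n x = x.
Proof. by apply: eq_from_tnth => i; rewrite tnth_mktuple -tnth_nth. Qed.

(* The tuples and sequences quantified over by [murec_eval] are coded by digits. *)
Lemma semidecidable_murec n (f : murec n) :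
  semidecidable (fun w => murec_eval f (tuple_nth n (behead w)) (nth 0 w 0)).
Proof.
elim: f => {n} /=.
- move=> n.
  have d := decidable_eq (computable_nth 0) (computable_const 0).
  by apply: eq_semidecidable (semidecidable_dec d) => w; split=> /eqP.
- have d := decidable_eq (computable_nth 0) (computable_succ (computable_nth 1)).
  apply: eq_semidecidable (semidecidable_dec d) => w.
  by rewrite [thead _]tnth_mktuple nth_behead; split=> /eqP.
- move=> n i.
  have d := decidable_eq (computable_nth 0) (computable_nth i.+1).
  apply: eq_semidecidable (semidecidable_dec d) => w.
  by rewrite tnth_mktuple nth_behead; split=> /eqP.
- move=> k n f IHf g IHg.
  (* Here [v] is [c :: b :: y :: x]: the code of the inner values, the result and the arguments. *)
  pose D i v := digit (nth 0 v 1) (nth 0 v 0) i.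
  have cD i : computable (D i).
    by apply: computable_digit; [exact: computable_nth..|exact: computable_const].
  pose G i v := D i v :: behead (behead (behead v)).
  pose H v := nth 0 v 2 :: mkseq (D^~ v) k.
  have sG : semidecidable (fun v => forall i : 'I_k,
      murec_eval (g i) (tuple_nth n (behead (G i v))) (nth 0 (G i v) 0)).
    apply: semidecidable_all_ord => i; apply: semidecidable_subst (IHg i) _.
    by solve_env.
  have sH : semidecidable (fun v =>
      murec_eval f (tuple_nth k (behead (H v))) (nth 0 (H v) 0)).
    apply: semidecidable_subst IHf _; solve_env; first exact: computable_nth.
    exact: computable_env_mkseq.
  have s := semidecidable_ex (semidecidable_ex (semidecidable_and sG sH)).
  apply: eq_semidecidable s => w; split=> [[b [c [gP fP]]]|[z [gP fP]]].
    exists (tuple_nth k (mkseq (digit b c) k)); split=> // i.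
    by rewrite tnth_mktuple nth_mkseq//; apply: gP.
  have [b [c bcP]] := digit_ex (nth 0 z) k.
  exists b, c; rewrite /G /H /D /=; split=> [i|].
    by rewrite bcP// -tnth_nth; apply: gP.
  rewrite (_ : tuple_nth _ _ = z)//; apply: eq_from_tnth => i.
  by rewrite tnth_mktuple nth_mkseq// bcP// -tnth_nth.
- move=> n f IHf g IHg.
  (* Here [v] is [c :: b :: y :: t :: x] with [t] the recursion argument; [H] is used one level
     deeper, on [i :: v]. *)
  pose G v := digit (nth 0 v 1) (nth 0 v 0) 0 :: behead (behead (behead (behead v))).
  pose H v := digit (nth 0 v 2) (nth 0 v 1) (nth 0 v 0).+1 :: nth 0 v 0 ::
    digit (nth 0 v 2) (nth 0 v 1) (nth 0 v 0) ::
    behead (behead (behead (behead (behead v)))).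
  have sG : semidecidable (fun v =>
      murec_eval f (tuple_nth n (behead (G v))) (nth 0 (G v) 0)).
    apply: semidecidable_subst IHf _; solve_env.
    by apply: computable_digit; [exact: computable_nth..|exact: computable_const].
  have sH : semidecidable (fun v => forall i, i < nth 0 v 3 ->
      murec_eval g (tuple_nth n.+2 (behead (H (i :: v)))) (nth 0 (H (i :: v)) 0)).
    apply: (@semidecidable_all_lt _ (fun v =>
      murec_eval g (tuple_nth n.+2 (behead (H v))) (nth 0 (H v) 0)));
      first exact: computable_nth.
    apply: (semidecidable_subst (G := H) IHg); solve_env.
    + by apply: computable_digit; [exact: computable_nth..|
        exact: computable_succ (computable_nth 0)].
    + exact: computable_nth.
    + by apply: computable_digit; exact: computable_nth.
  have d : decidable_on (fun v =>
      nth 0 v 2 == digit (nth 0 v 1) (nth 0 v 0) (nth 0 v 3)).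
    apply: decidable_eq; first exact: computable_nth.
    by apply: computable_digit; exact: computable_nth.
  have s := semidecidable_ex (semidecidable_ex
    (semidecidable_and sG (semidecidable_and sH (semidecidable_dec d)))).
  apply: eq_semidecidable s => w.
  have -> : thead (tuple_nth n.+1 (behead w)) = nth 0 w 1.
    by rewrite [thead _]tnth_mktuple nth_behead.
  have tupE a b : [tuple of a :: b :: behead (tuple_nth n.+1 (behead w))] =
      tuple_nth n.+2 (a :: b :: behead (behead w)).
    by rewrite -!tuple_nth_cons -[in RHS]tuple_nth_behead; apply: val_inj.
  rewrite tuple_nth_behead; split=> [[b [c [fP [gP /eqP yE]]]]|[h [fP gP yE]]].
    exists (digit b c); split=> // i lti.
    by have := gP i lti; rewrite -tupE.
  (* A recursion of length [t] has the [t.+1] values [h 0], ..., [h t]. *)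
  have [b [c bcP]] := digit_ex h (nth 0 w 1).+1.
  exists b, c; rewrite /G /H /=; split; first by rewrite bcP.
  split; last by rewrite yE bcP.
  move=> i lti; rewrite !bcP//; last exact: ltnW.
  by have := gP i lti; rewrite tupE.
- move=> n f IHf.
  (* With [w = y :: x], [G] asks for the value 0 at [y], and [H], on [z :: i :: w], for the value
     [z.+1] at [i]. *)
  pose G w := 0 :: nth 0 w 0 :: behead w.
  pose H v := (nth 0 v 0).+1 :: nth 0 v 1 :: behead (behead (behead v)).
  have sG : semidecidable (fun v =>
      murec_eval f (tuple_nth n.+1 (behead (G v))) (nth 0 (G v) 0)).
    apply: semidecidable_subst IHf _; solve_env.
    + exact: computable_const.
    + exact: computable_nth.
  have sH : semidecidable (fun v => forall i, i < nth 0 v 0 -> exists z,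
      murec_eval f (tuple_nth n.+1 (behead (H (z :: i :: v))))
        (nth 0 (H (z :: i :: v)) 0)).
    apply: (@semidecidable_all_lt _ (fun v => exists z,
      murec_eval f (tuple_nth n.+1 (behead (H (z :: v)))) (nth 0 (H (z :: v)) 0)));
      first exact: computable_nth.
    apply: (@semidecidable_ex (fun v =>
      murec_eval f (tuple_nth n.+1 (behead (H v))) (nth 0 (H v) 0))).
    apply: (semidecidable_subst (G := H) IHf); solve_env.
    + exact: computable_succ (computable_nth 0).
    + exact: computable_nth.
  apply: eq_semidecidable (semidecidable_and sG sH) => w.
  rewrite /G /H /= tuple_nth_cons; split=> -[fP gP]; split=> // i /gP.
    by rewrite tuple_nth_cons.
  by rewrite tuple_nth_cons.
Qed.

(** A domain is the projection of a graph; conversely, unbounded search halts exactly when there is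
    a witness. *)
Lemma ce_semidecidable (A : set nat) :
  ce A <-> semidecidable (fun w => A (nth 0 w 0)).
Proof.
split=> [[f fP]|[F dF FP]].
  pose G v := nth 0 v 0 :: [:: nth 0 v 1].
  have sG : semidecidable (fun v =>
      murec_eval f (tuple_nth 1 (behead (G v))) (nth 0 (G v) 0)).
    apply: (semidecidable_subst (G := G) (semidecidable_murec f)).
    by solve_env; exact: computable_nth.
  apply: eq_semidecidable (semidecidable_ex sG) => w; rewrite fP /G /=.
  have -> : tuple_nth 1 [:: nth 0 w 0] = [tuple nth 0 w 0].
    by apply: eq_from_tnth => i; rewrite tnth_mktuple (tnth_nth 0).
  by [].
(* [Mu] searches for a zero, hence the negation; before the least witness the value is 1, so the
   search continues. *)
have [c cP] := decidable_neg dF 2.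
exists (Mu c) => x; rewrite (FP [:: x]); split=> [[s Fs]|[y [cy _]]]; last first.
  exists y; apply/negbNE; apply/negP => nF.
  by have := murec_eval_fun cy (cP _); rewrite /= nF.
have exF : exists s, F [:: s; x] by exists s.
exists (ex_minn exF); case: ex_minnP => {Fs}s Fs smin; split.
  by have := cP [tuple s; x]; rewrite /= Fs.
move=> i lti; exists 0; have := cP [tuple i; x]; rewrite /=.
by case: (boolP (F [:: i; x])) => [/smin|//]; rewrite leqNgt lti.
Qed.

Lemma Pi02_semidecidable n (P : set (n.-tuple nat)) :
  Pi02 P <-> exists2 Q, semidecidable Q &
    forall x : n.-tuple nat, P x <-> forall y, Q (y :: x).
Proof.
split=> [[D [f fP] PD]|[Q [F dF FP] PQ]].
  (* [f] has one arity only, whereas [computable] asks for all, so [D] is expressed by the graph of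
     [f] at the truth value 1. *)
  pose G v := 1 :: nth 0 v 1 :: nth 0 v 0 :: behead (behead v).
  exists (fun w => exists z,
    murec_eval f (tuple_nth n.+2 (behead (G (z :: w)))) (nth 0 (G (z :: w)) 0)).
    apply: (@semidecidable_ex (fun v =>
      murec_eval f (tuple_nth n.+2 (behead (G v))) (nth 0 (G v) 0))).
    apply: (semidecidable_subst (G := G) (semidecidable_murec f)).
    solve_env; [exact: computable_const|exact: computable_nth..].
  move=> x; rewrite PD.
  suff H y z : D [tuple of y :: z :: x] <->
      murec_eval f (tuple_nth n.+2 [:: y, z & x]) 1.
    by split=> W y; have [z /H] := W y; exists z.
  rewrite (tuple_nthK [tuple of y :: z :: x]); split=> [Dyz|fyz].
    by have := fP [tuple of y :: z :: x]; rewrite asboolT.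
  apply: contrapT => nD.
  by have := murec_eval_fun fyz (fP _); rewrite asboolF.
(* In [F] the witness [z] comes first, in [Pi02] the outer variable [y]. *)
pose G v := nth 0 v 1 :: nth 0 v 0 :: behead (behead v).
have dG : decidable_on (fun v => F (G v)).
  by apply: decidable_subst => //; solve_env; exact: computable_nth.
have [c cP] := dG n.+2.
exists (fun v : n.+2.-tuple nat => F (G v)); first by exists c => v; rewrite asboolb.
by move=> x; rewrite PQ; split=> W y; have := W y; rewrite FP.
Qed.

(** * Rational codes and left-$\Pi^0_2$ reals *)

Import Order.TTheory GRing.Theory Num.Theory.
Local Open Scope classical_set_scope.
Local Open Scope ring_scope.

Definition code_val (R : realType) (i j k : nat) : R := (i%:R - j%:R) / k.+1%:R.

(** Passes from rationals to real values of codes, so that the entries of a code become variables of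
    [Q]. *)
Lemma left_Pi02_semidecidable (R : realType) (a : R) :
  left_Pi02 a <-> exists2 Q, semidecidable Q &
    forall i j k, code_val R i j k < a <-> forall y, Q [:: y; i; j; k].
Proof.
have codeE (t : 3.-tuple nat) : ratr (rat_of_code t) =
    code_val R (tnth t 0) (tnth t 1) (tnth t 2%:R).
  by rewrite /rat_of_code /code_val fmorph_div rmorphB /= !rmorph_nat.
have tE (t : 3.-tuple nat) : t = [tuple tnth t 0; tnth t 1; tnth t 2%:R].
  apply: eq_from_tnth => i; rewrite [RHS](tnth_nth 0%N).
  by case: i => -[|[|[|//]]] lt /=; congr tnth; apply: val_inj.
rewrite /left_Pi02 /Pi02_rat Pi02_semidecidable.
split=> -[Q sQ QP]; exists Q => //.
  move=> i j k; have := QP [tuple i; j; k]; rewrite /= codeE.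
  by rewrite !(tnth_nth 0%N).
by move=> t; rewrite /= codeE QP [in X in _ <-> X](tE t).
Qed.

(** * Upper densities of c.e. sets *)

(** Cross-multiplying and moving the negative parts across leaves natural numbers only, hence a
    decidable comparison. *)
Lemma code_val_lt (R : realType) i j k i' j' k' :
  (code_val R i j k < code_val R i' j' k') =
  (i * k'.+1 + j' * k.+1 < i' * k.+1 + j * k'.+1)%N.
Proof.
rewrite ltr_pdivlMr ?ltr0Sn// mulrAC ltr_pdivrMr ?ltr0Sn//.
rewrite -(ltr_nat R) !natrD !natrM -[LHS]subr_gt0 -[RHS]subr_gt0.
by congr (_ < _); ring.
Qed.

(** The rationals are dense, and each has a code in which [i] or [j] is 0, according to its sign. *)
Lemma code_val_dense (R : realType) (x y : R) :
  x < y -> exists i j k, x < code_val R i j k < y.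
Proof.
move=> /rat_in_itvoo[q]; rewrite in_itv /= => qxy.
suff [i [j [k qE]]] : exists i j k, code_val R i j k = ratr q
  by exists i, j, k; rewrite qE.
have den : (`|denq q|.-1.+1)%:R = (denq q)%:~R :> R.
  by rewrite prednK ?absz_gt0 ?denq_neq0// natr_absz ger0_norm// denq_ge0.
rewrite /code_val /ratr; case: (intP (numq q)) => [|n|n].
- by exists 0%N, 0%N, 0%N; rewrite subrr !mul0r.
- by exists n.+1, 0%N, `|denq q|.-1; rewrite den subr0.
- by exists 0%N, n.+1, `|denq q|.-1; rewrite den sub0r mulrNz.
Qed.

(** A rational has a decidable cut, by [code_val_lt]; this settles rational upper densities. *)
Lemma left_Pi02_code_val (R : realType) i j k : left_Pi02 (code_val R i j k).
Proof.
apply/left_Pi02_semidecidable.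
exists (fun w => nth 0%N w 1 * k.+1 + j * (nth 0%N w 3).+1 <
   i * (nth 0%N w 3).+1 + nth 0%N w 2 * k.+1)%N; last first.
  by move=> i' j' k'; rewrite code_val_lt; split=> // /(_ 0%N).
apply: semidecidable_dec; apply: decidable_leq.
  by apply: computable_succ; apply: computable_add; apply: computable_mul;
    do ?[exact: computable_const | exact: computable_nth | apply: computable_succ].
by apply: computable_add; apply: computable_mul;
  do ?[exact: computable_const | exact: computable_nth | apply: computable_succ].
Qed.

Definition count_below (A : set nat) (m : nat) : nat := \sum_(i < m) `[< A i >].

Lemma rhoE (R : realType) A m : rho R A m = (count_below A m)%:R / m%:R.
Proof.
by rewrite /rho /count_below -sum1_card [in RHS]big_mkcond /= big_mkcond.
Qed.

Lemma count_below_le A m : (count_below A m <= m)%N.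
Proof. by rewrite -[leqRHS]card_ord -sum1_card leq_sum// => i _; case: asbool. Qed.

Lemma rho_ge0 (R : realType) A m : 0 <= rho R A m.
Proof. by rewrite rhoE divr_ge0. Qed.

Lemma rho_le1 (R : realType) A m : rho R A m <= 1.
Proof.
rewrite rhoE; case: m => [|m]; first by rewrite invr0 mulr0.
by rewrite ler_pdivrMr ?ltr0Sn// mul1r ler_nat count_below_le.
Qed.

(** Lower bounds on the count are confirmed by enumeration, since some stage [s] has enumerated all
    members below [m]. *)
Lemma semidecidable_count_below A : semidecidable (fun w => A (nth 0%N w 0)) ->
  semidecidable (fun w => nth 0%N w 0 <= count_below A (nth 0%N w 1))%N.
Proof.
move=> /semidecidable_mono[F [dF FP Fm]].
pose G v := [:: nth 0%N v 1; nth 0%N v 0].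
exists (fun w => nth 0%N w 1 <= \sum_(i < nth 0%N w 2) F (G (val i :: w)))%N.
  apply: decidable_leq; first exact: computable_nth.
  apply: (@computable_sum _ (fun v => F (G v))); first exact: computable_nth.
  by apply: (computable_subst dF (G := G)); solve_env; exact: computable_nth.
move=> w; rewrite /G /= /count_below; move: (nth 0%N w 0) (nth 0%N w 1) => c m.
have AF i : A i <-> exists s, F [:: s; i] := FP [:: i].
split=> [cm|[s cs]]; last first.
  apply: leq_trans cs _; apply: leq_sum => i _.
  by case: (boolP (F _)) => // Fsi; rewrite asboolT// AF; exists s.
suff [s sP] : exists s, forall i, (i < m)%N -> A i -> F [:: s; i].
  exists s; apply: leq_trans cm _; apply: leq_sum => i _.
  by case: asboolP => // /sP ->.
elim: m {cm} => [|m [s sP]]; first by exists 0%N.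
have [/AF[t tP]|nA] := EM (A m); last first.
  by exists s => i; rewrite ltnS leq_eqVlt => /orP[/eqP ->|/sP].
exists (maxn s t) => i; rewrite ltnS leq_eqVlt => /orP[/eqP -> _|lti Ai].
  by apply: Fm tP; exact: leq_maxr.
by apply: Fm (sP i lti Ai); exact: leq_maxl.
Qed.

(** The limsup of [rho R A m], written close to the quantifiers of a $\Pi^0_2$ cut. *)
Definition upper_density (R : realType) (A : set nat) : R :=
  sup [set q | forall N, exists2 m, (N < m)%N & q < rho R A m].

Lemma lt_upper_density (R : realType) A (q : R) :
  q < upper_density R A -> forall N, exists2 m, (N < m)%N & q < rho R A m.
Proof.
move=> /sup_gt[|y yP qy N].
  (* The supremum is over a nonempty set, as [-1] lies below every value of [rho]. *)
  by exists (-1) => N; exists N.+1 => //; apply: lt_le_trans (rho_ge0 _ _ _).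
by have [m ltm ym] := yP N; exists m => //; apply: lt_trans ym.
Qed.

Lemma le_upper_density (R : realType) A (q : R) :
  (forall N, exists2 m, (N < m)%N & q < rho R A m) -> q <= upper_density R A.
Proof.
move=> qP; apply: ub_le_sup => //; exists 1 => p /(_ 0%N)[m _ /ltW pm].
exact: le_trans pm (rho_le1 _ _ _).
Qed.

(** Comparison of limsups up to a shift, meant for [c] equal to [r] and to [- r]. *)
Lemma upper_density_leD (R : realType) A B (c : R) :
  (forall e, 0 < e -> exists N, forall m, (N <= m)%N ->
    rho R A m <= rho R B m + c + e) ->
  upper_density R A <= upper_density R B + c.
Proof.
move=> H; apply/ler_addgt0Pr => e e0; rewrite -lerBlDr -lerBlDr.
have e20 : 0 < e / 2 by rewrite divr_gt0.
have [N NP] := H _ e20; apply: le_upper_density => N'.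
(* One half of [e] pays for approaching the supremum, the other for the hypothesis. *)
have [|m] := @lt_upper_density _ A (upper_density R A - e / 2) _ (maxn N N').
  by rewrite ltrBlDr ltrDl.
rewrite gtn_max => /andP[Nm N'm] Am; exists m => //.
by have := NP m (ltnW Nm); lra.
Qed.

Lemma code_val_lt_rho (R : realType) A m i j k : (0 < m)%N ->
  (code_val R i j k < rho R A m) =
  (i * m < count_below A m * k.+1 + j * m)%N.
Proof.
case: m => // m _; have := code_val_lt R i j k (count_below A m.+1) 0 m.
by rewrite mul0n addn0 => <-; rewrite rhoE /code_val subr0.
Qed.

(* [q < L] and [rho R A m > q] for infinitely many [m] differ only at [q = L],
   so irrational and rational [L] are treated separately. *)
Lemma left_Pi02_upper_density (R : realType) A :
  ce A -> left_Pi02 (upper_density R A).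
Proof.
move=> /ce_semidecidable/semidecidable_count_below sA.
have [[i [j [k ->]]]|irr] := EM (exists i j k, upper_density R A = code_val R i j k).
  exact: left_Pi02_code_val.
apply/left_Pi02_semidecidable.
(* The entries of [v] are [c], [m], [N], [i], [j], [k]. Here [c] is a confirmed lower bound of the
   count, as the count itself need not be computable. *)
pose dec v := ((nth 0 v 2 < nth 0 v 1) && (nth 0 v 3 * nth 0 v 1 <
  nth 0 v 0 * (nth 0 v 5).+1 + nth 0 v 4 * nth 0 v 1))%N.
have ddec : decidable_on dec.
  apply: decidable_and; apply: decidable_leq;
  do ?[exact: computable_const | exact: computable_nth | apply: computable_succ
      | apply: computable_add | apply: computable_mul].
exists (fun w => exists m c, (c <= count_below A m)%N /\ dec [:: c, m & w]).
  apply: (@semidecidable_ex (fun w =>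
    exists c, (c <= count_below A (nth 0%N w 0))%N /\ dec (c :: w))).
  apply: (@semidecidable_ex (fun v =>
    (nth 0%N v 0 <= count_below A (nth 0%N v 1))%N /\ dec v)).
  apply: semidecidable_and; last exact: semidecidable_dec.
  pose G v := [:: nth 0%N v 0; nth 0%N v 1].
  apply: (semidecidable_subst (G := G) sA).
  by solve_env; exact: computable_nth.
move=> i j k; split=> [qL N|qL].
  have [m ltm qm] := lt_upper_density qL N.
  exists m, (count_below A m); split=> //; apply/andP; split=> //=.
  by rewrite -(code_val_lt_rho R)// (leq_trans _ ltm).
rewrite lt_neqAle; apply/andP; split.
  by apply/eqP => qE; apply: irr; exists i, j, k.
apply: le_upper_density => N; have [m [c [cA /andP[/= ltm cm]]]] := qL N.
exists m => //; rewrite code_val_lt_rho ?(leq_trans _ ltm)//.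
by apply: leq_trans cm _; rewrite leq_add2r leq_mul2r cA orbT.
Qed.

(** * Densities of d.c.e. sets as differences of upper densities *)

Lemma has_densityP (R : realType) X (r : R) : has_density X r <->
  forall e, 0 < e -> exists N, forall m, (N <= m)%N -> `|rho R X m - r| <= e.
Proof.
split=> [/cvgrPdist_le H e /H[N _ NP]|H].
  by exists N => m /NP /=; rewrite distrC.
apply/cvgrPdist_le => e /H[N NP]; exists N => // m /NP /=.
by rewrite distrC.
Qed.

Lemma has_density_itv (R : realType) X (r : R) : has_density X r -> 0 <= r <= 1.
Proof.
move=> /has_densityP H; apply/andP; split; apply/ler_addgt0Pr => e /H[N NP].
  by have := NP N (leqnn N); have := rho_ge0 R X N; rewrite ler_norml; lra.
by have := NP N (leqnn N); have := rho_le1 R X N; rewrite ler_norml; lra.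
Qed.

Lemma ceI A B : ce A -> ce B -> ce (A `&` B).
Proof.
move=> /ce_semidecidable sA /ce_semidecidable sB; apply/ce_semidecidable.
exact: semidecidable_and.
Qed.

Lemma rho_setD (R : realType) A B m :
  rho R (A `\` B) m = rho R A m - rho R (A `&` B) m.
Proof.
rewrite !rhoE -mulrBl; congr (_ / _); apply/eqP; rewrite eq_sym subr_eq -natrD.
rewrite /count_below -big_split /=; apply/eqP; congr _%:R.
apply: eq_bigr => i _; have [Ai|nA] := EM (A i); last first.
  by rewrite !asboolF// => -[].
have [Bi|nB] := EM (B i).
  by rewrite (asboolT Ai) (asboolF (P := (A `\` B) i)) ?asboolT// => -[].
by rewrite (asboolT Ai) (asboolF (P := (A `&` B) i)) ?asboolT// => -[].
Qed.

(** Limsups do not subtract in general; here they do, because the difference of the two sequences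
    converges to [r]. *)
Lemma dce_density_D2 (R : realType) X (r : R) :
  dce X -> has_density X r -> D2 r.
Proof.
move=> [A [B [ceA ceB ->]]] /has_densityP H.
exists (upper_density R A), (upper_density R (A `&` B)).
split; [exact: left_Pi02_upper_density|exact/left_Pi02_upper_density/ceI|].
have le1 : upper_density R A <= upper_density R (A `&` B) + r.
  apply: upper_density_leD => e /H[N NP]; exists N => m /NP.
  by rewrite rho_setD ler_norml; lra.
have le2 : upper_density R (A `&` B) <= upper_density R A + - r.
  apply: upper_density_leD => e /H[N NP]; exists N => m /NP.
  by rewrite rho_setD ler_norml; lra.
by apply/eqP; rewrite eq_le; apply/andP; split; lra.
Qed.

(** * A uniformly distributed sequence *)

(** The integer square root, as a bounded count so that it is computable. *)
Definition isqrt (x : nat) : nat := \sum_(i < x) (i.+1 ^ 2 <= x)%N.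

Lemma isqrt_unique n x : (n ^ 2 <= x < n.+1 ^ 2)%N -> isqrt x = n.
Proof.
move=> /andP[lenx ltxn]; have le_nx : (n <= x)%N by nia.
rewrite /isqrt -[RHS](minn_idPr le_nx) -sum_nat_ltn; apply: eq_bigr => i _.
congr nat_of_bool; apply/idP/idP => [leix|ltin]; last first.
  by apply: leq_trans lenx; rewrite leq_sqr.
by rewrite -ltnS -ltn_sqr; apply: leq_ltn_trans ltxn.
Qed.

Lemma isqrt_bounds x : (isqrt x ^ 2 <= x < (isqrt x).+1 ^ 2)%N.
Proof.
suff [n nP] : exists n, (n ^ 2 <= x < n.+1 ^ 2)%N by rewrite (isqrt_unique nP).
elim: x => [|x [n /andP[lenx ltxn]]]; first by exists 0%N.
have [leq|lt] := leqP (n.+1 ^ 2) x.+1; last by exists n; rewrite lt ltnW.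
by exists n.+1; rewrite leq /=; move: ltxn; rewrite !expnS; lia.
Qed.

Lemma computable_isqrt F : computable F -> computable (fun x => isqrt (F x)).
Proof.
move=> cF; pose L v := ((nth 0 v 0).+1 ^ 2 <= nth 0 v 1)%N.
have dL : decidable_on L.
  apply: decidable_leq; last exact: computable_nth.
  apply: computable_exp; last exact: computable_const.
  exact: computable_succ (computable_nth 0).
pose G x := [:: F x].
have cS : computable (fun v => \sum_(i < nth 0 v 0) L (val i :: v))%N.
  exact: computable_sum (computable_nth 0) dL.
by apply: (computable_subst (G := G) cS); solve_env.
Qed.

(* The block [n^2 <= x < (n+1)^2] enumerates the multiples of [1/(2n+1)] in [0, 1);
   as blocks have negligible length, [position] is uniformly distributed. *)
Definition position (R : realType) (x : nat) : R :=
  (x - isqrt x ^ 2)%:R / (isqrt x).*2.+1%:R.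

(** Exactly $\lceil s\rceil$ naturals lie below [s]. *)
Lemma count_ltr_le (R : realType) (s : R) L :
  0 <= s -> (\sum_(j < L) (j%:R < s :> R)%R)%:R <= s + 1.
Proof.
move=> s0; elim: L => [|L IHL]; first by rewrite big_ord0 addr_ge0.
rewrite big_ord_recr /=; case: ltP => [Ls|_]; last by rewrite addn0.
apply: le_trans (_ : (L + 1)%:R <= _); last by rewrite natrD lerD2r ltW.
rewrite ler_nat leq_add2r -[leqRHS]card_ord -sum1_card leq_sum// => i _.
by case: (_ < _).
Qed.

(** Since [s <= L%:R], the count misses no natural below [s]. *)
Lemma count_ltr_ge (R : realType) (s : R) L :
  s <= L%:R -> s <= (\sum_(j < L) (j%:R < s :> R)%R)%:R.
Proof.
elim: L => [|L IHL] sL; first by rewrite big_ord0.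
have [Ls|sL'] := ltP L%:R s; last first.
  apply: le_trans (IHL sL') _; rewrite big_ord_recr natrD lerDl //.
rewrite (_ : \sum_(j < _) _ = L.+1)%N// -[RHS]card_ord -sum1_card.
apply: eq_bigr => i _; rewrite (le_lt_trans _ Ls)//.
by rewrite ler_nat -ltnS.
Qed.

Lemma count_position_block (R : realType) (t : R) n :
  (\sum_(n ^ 2 <= x < n.+1 ^ 2) (position R x < t)%R =
   \sum_(j < n.*2.+1) (j%:R < t * n.*2.+1%:R)%R)%N.
Proof.
have -> : (n.+1 ^ 2 = n.*2.+1 + n ^ 2)%N by rewrite !expnS !expn0; lia.
rewrite -{1}[(n ^ 2)%N]add0n big_addn addnK big_mkord.
apply: eq_bigr => j _; congr nat_of_bool.
rewrite /position (@isqrt_unique n) ?addnK ?ltr_pdivrMr//.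
by have := ltn_ord j; rewrite !expnS !expn0; lia.
Qed.

Definition position_below (R : realType) (t : R) : set nat :=
  [set x | position R x < t].

Lemma count_position_split (R : realType) (t : R) m n : (m <= n)%N ->
  count_below (position_below t) n = (count_below (position_below t) m +
    \sum_(m <= x < n) (position R x < t)%R)%N.
Proof.
move=> lemn; rewrite /count_below.
rewrite -!(big_mkord xpredT (fun i => nat_of_bool `[< position_below t i >])).
rewrite (big_cat_nat (leq0n m) lemn) /=; congr addn.
by apply: eq_bigr => i _; rewrite asboolb.
Qed.

(** Each of the [n] complete blocks adds an error of at most 1. *)
Lemma count_position_sqr_le (R : realType) (t : R) n : 0 <= t ->
  (count_below (position_below t) (n ^ 2))%:R <= t * (n ^ 2)%:R + n%:R.
Proof.
move=> t0; elim: n => [|n IHn]; first by rewrite /count_below big_ord0 mulr0 addr0.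
rewrite (count_position_split t (_ : n ^ 2 <= n.+1 ^ 2)%N) ?leq_sqr//.
rewrite count_position_block natrD.
have := count_ltr_le n.*2.+1 (mulr_ge0 t0 (ler0n _ n.*2.+1)).
have -> : (n.+1 ^ 2 = n.*2.+1 + n ^ 2)%N by rewrite !expnS !expn0; lia.
by rewrite natrD mulrDr -[n.+1]addn1 [(n + 1)%:R]natrD; lra.
Qed.

(** No block loses anything: [t <= 1] puts the threshold of each block within its length, as
    [count_ltr_ge] requires. *)
Lemma count_position_sqr_ge (R : realType) (t : R) n : t <= 1 ->
  t * (n ^ 2)%:R <= (count_below (position_below t) (n ^ 2))%:R.
Proof.
move=> t1; elim: n => [|n IHn]; first by rewrite /count_below big_ord0 mulr0.
rewrite (count_position_split t (_ : n ^ 2 <= n.+1 ^ 2)%N) ?leq_sqr//.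
rewrite count_position_block natrD.
have := @count_ltr_ge R (t * n.*2.+1%:R) n.*2.+1 (ler_piMl (ler0n _ _) t1).
have -> : (n.+1 ^ 2 = n.*2.+1 + n ^ 2)%N by rewrite !expnS !expn0; lia.
by rewrite natrD mulrDr; lra.
Qed.

Lemma count_position_le (R : realType) (t : R) m : 0 <= t ->
  (count_below (position_below t) m)%:R <= t * m%:R + 3 * (isqrt m)%:R.
Proof.
move=> t0; have /andP[le_m lt_m] := isqrt_bounds m.
rewrite (count_position_split t le_m) natrD.
have := count_position_sqr_le (isqrt m) t0.
(* The incomplete last block has at most [2 * isqrt m] elements; with the error from complete blocks
   this makes 3. *)
have : (\sum_(isqrt m ^ 2 <= x < m) (position R x < t)%R)%:R <= 2 * (isqrt m)%:R :> R.
  rewrite -natrM ler_nat (@leq_trans (m - isqrt m ^ 2))//; last first.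
    by move: lt_m; rewrite !expnS !expn0; lia.
  by rewrite -[leqRHS]muln1 -sum_nat_const_nat leq_sum// => i _; case: (_ < _).
have : t * (isqrt m ^ 2)%:R <= t * m%:R by rewrite ler_wpM2l ?ler_nat.
by lra.
Qed.

Lemma count_position_ge (R : realType) (t : R) m : 0 <= t <= 1 ->
  t * m%:R - 3 * (isqrt m)%:R <= (count_below (position_below t) m)%:R.
Proof.
move=> /andP[t0 t1]; have /andP[le_m lt_m] := isqrt_bounds m.
rewrite (count_position_split t le_m) natrD.
have := count_position_sqr_ge (isqrt m) t1.
have : 0 <= (\sum_(isqrt m ^ 2 <= x < m) (position R x < t)%R)%:R :> R by [].
have : m%:R <= (isqrt m ^ 2)%:R + 2 * (isqrt m)%:R :> R.
  rewrite -natrM -natrD ler_nat; move: lt_m; rewrite !expnS !expn0; lia.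
move=> /(ler_wpM2l t0); rewrite mulrDr.
have : t * (2 * (isqrt m)%:R) <= 2 * (isqrt m)%:R by rewrite ler_piMl ?mulr_ge0.
have : 0 <= (isqrt m)%:R :> R by [].
by lra.
Qed.

(** * Errors that vanish in density *)

Lemma natr_eventually_le (R : realType) (x e : R) :
  0 < e -> exists N, forall m, (N <= m)%N -> x <= e * m%:R.
Proof.
move=> e0; exists (Num.truncn (x / e)).+1 => m lem.
rewrite mulrC -ler_pdivrMr//; apply: le_trans (ltW (truncnS_gt _)) _.
by rewrite ler_nat.
Qed.

(** Once [3 <= e * isqrt m], multiply by [isqrt m] and use [isqrt m ^ 2 <= m]. *)
Lemma isqrt_eventually_le (R : realType) (e : R) : 0 < e ->
  exists N, forall m, (N <= m)%N -> 3 * (isqrt m)%:R <= e * m%:R.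
Proof.
move=> e0; have [N NP] := natr_eventually_le 3 e0.
exists (N ^ 2)%N => m leNm; have /andP[le_m lt_m] := isqrt_bounds m.
have leN : (N <= isqrt m)%N.
  by rewrite -ltnS -ltn_sqr; apply: leq_ltn_trans lt_m.
apply: le_trans (_ : e * (isqrt m ^ 2)%:R <= _); last first.
  by rewrite ler_wpM2l ?(ltW e0)// ler_nat.
by rewrite expnS expn1 natrM mulrA ler_wpM2r// NP.
Qed.

(** Thresholds above 1 must be covered, as [a - s + eps / 4] may be one. *)
Lemma rho_position_le (R : realType) (t e : R) : 0 <= t -> 0 < e ->
  exists N, forall m, (N <= m)%N -> rho R (position_below t) m <= t + e.
Proof.
move=> t0 /isqrt_eventually_le[N NP]; exists N.+1 => -[//|m] leN.
rewrite rhoE ler_pdivrMr// mulrDl; apply: le_trans (count_position_le _ t0) _.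
by rewrite lerD2l NP// ltnW.
Qed.

Lemma rho_position_ge (R : realType) (t e : R) : 0 <= t <= 1 -> 0 < e ->
  exists N, forall m, (N <= m)%N -> t - e <= rho R (position_below t) m.
Proof.
move=> t01 /isqrt_eventually_le[N NP]; exists N.+1 => -[//|m] leN.
rewrite rhoE ler_pdivlMr// mulrBl; apply: le_trans (count_position_ge _ t01).
by rewrite lerD2l lerN2 NP// ltnW.
Qed.

(** Finitely many exceptions change the counts by a bounded amount. With two sets on each side, a
    single inequality expresses an inclusion together with disjointness, or a covering by a
    union. *)
Lemma rho_almost_le (R : realType) (A B C D : set nat) (N : nat) (e : R) : 0 < e ->
  (forall x, (N <= x)%N -> `[< A x >] + `[< B x >] <= `[< C x >] + `[< D x >])%N ->
  exists M, forall m, (M <= m)%N ->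
    rho R A m + rho R B m <= rho R C m + rho R D m + e.
Proof.
move=> /(natr_eventually_le (2 * N%:R))[M MP] H; exists M.+1 => -[//|m] leM.
have lec k : (count_below A k + count_below B k <=
    count_below C k + count_below D k + N.*2)%N.
  rewrite /count_below -!big_split /=.
  (* Below [N] the left side can exceed the right side by at most 2. *)
  apply: (@leq_trans
    (\sum_(i < k) (`[< C i >] + `[< D i >] + (i < N).*2))%N); last first.
    rewrite big_split /= leq_add2l -(big_morph _ doubleD double0) leq_double.
    by rewrite sum_nat_ltn geq_minr.
  apply: leq_sum => i _; have [/H|_] := leqP N i; first by rewrite addn0.
  by case: asbool; case: asbool; case: asbool; case: asbool.
rewrite !rhoE -!mulrDl -lerBlDl -mulrBl ler_pdivrMr//.
apply: le_trans (MP _ (ltnW leM)); have := lec m.+1.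
by rewrite -(ler_nat R) -muln2 !natrD natrM; lra.
Qed.

(** * Densities of d.c.e. sets *)

Lemma decidable_position_lt (R : realType) c d e :
  decidable_on (fun w => position R (nth 0%N w 0) + code_val R c d e <
    code_val R (nth 0%N w 1) (nth 0%N w 2) (nth 0%N w 3)).
Proof.
pose n w := isqrt (nth 0%N w 0).
(* The position plus the shift is the fraction [(U w - V w) / (W w).+1], which is again the value of
   a code. *)
pose U w := ((nth 0 w 0 - n w ^ 2) * e.+1 + c * (n w * 2).+1)%N.
pose V w := (d * (n w * 2).+1)%N.
pose W w := ((n w * 2) * e.+1 + e)%N.
have cn : computable n := computable_isqrt (computable_nth 0).
have dlt : decidable_on (fun w => U w * (nth 0 w 3).+1 + nth 0 w 2 * (W w).+1 <
    nth 0 w 1 * (W w).+1 + V w * (nth 0 w 3).+1)%N.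
  apply: decidable_leq;
  do ?[exact: cn | exact: computable_const | exact: computable_nth
      | apply: computable_succ | apply: computable_add | apply: computable_mul
      | apply: computable_sub | apply: computable_exp].
apply: eq_decidable dlt => w; rewrite -(code_val_lt R); congr (_ < _).
have WE : (W w).+1%:R = (n w).*2.+1%:R * e.+1%:R :> R.
  by rewrite -natrM; congr _%:R; rewrite /W; lia.
rewrite /code_val /position WE -/(n w) /U /V muln2 !natrD !natrM.
by field; rewrite !nat1r !pnatr_eq0.
Qed.

(* Membership of [x] is decided by all codes [q <= position x + s] with numbers at
   most [x]: each [q < a] eventually lets every [x] through, each [q >= a] eventually
   blocks every [x] with [position x + s >= q]. *)
Lemma ce_of_left_Pi02 (R : realType) (a : R) c d e : left_Pi02 a ->
  let s := code_val R c d e in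
  exists A : set nat, [/\ ce A, forall x, position R x + s < a -> A x &
    forall t, a < t -> exists N, forall x, (N <= x)%N -> A x -> position R x + s < t].
Proof.
move=> /left_Pi02_semidecidable[Q sQ QP] s.
pose lt_pos w := position R (nth 0%N w 0) + s <
  code_val R (nth 0%N w 1) (nth 0%N w 2) (nth 0%N w 3).
(* Each inner quantifier puts its variable in front, so [v] is [[:: y; k; j; i; x]]. *)
pose G v := [:: nth 0 v 4; nth 0 v 3; nth 0 v 2; nth 0 v 1]%N.
pose H v := [:: nth 0 v 0; nth 0 v 3; nth 0 v 2; nth 0 v 1]%N.
pose P v := ~~ lt_pos (G v) -> Q (H v).
pose A x := forall i, (i < x.+1)%N -> forall j, (j < x.+1)%N ->
  forall k, (k < x.+1)%N -> forall y, (y < x.+1)%N -> P [:: y; k; j; i; x].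
exists A; split.
- apply/ce_semidecidable.
  have sP : semidecidable P.
    apply: semidecidable_imply.
      apply: decidable_neg; apply: (decidable_subst (G := G)).
        exact: decidable_position_lt.
      by solve_env; exact: computable_nth.
    by apply: (semidecidable_subst (G := H) sQ); solve_env; exact: computable_nth.
  have bnd i : computable (fun w => (nth 0 w i).+1)%N.
    exact: computable_succ (computable_nth i).
  have := semidecidable_all_lt (bnd 0%N) (semidecidable_all_lt (bnd 1%N)
    (semidecidable_all_lt (bnd 2%N) (semidecidable_all_lt (bnd 3%N) sP))).
  exact: eq_semidecidable.
(* A code with value at most [position R x + s] is below [a], so all its instances of [Q] hold. *)
- move=> x xa i _ j _ k _ y _; rewrite /P /lt_pos /= -leNgt => qx.
  by apply: (QP i j k).1; apply: le_lt_trans xa.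
- move=> t /code_val_dense[i [j [k /andP[aq qt]]]].
  have [y nQ] : exists y, ~ Q [:: y; i; j; k].
    by apply/not_existsP => /= allQ; have := (QP i j k).2 (fun y => contrapT (allQ y));
      rewrite ltNge (ltW aq).
  (* From here on, the code of a rational between [a] and [t] and its failing instance [y] lie
     within the search bounds of [x]. *)
  exists (maxn (maxn i j) (maxn k y)) => x.
  rewrite !geq_max => /andP[/andP[ix jx] /andP[kx yx]] Ax.
  apply: lt_trans qt; apply/negPn/negP => nlt.
  exact: nQ (Ax i ix j jx k kx y yx nlt).
Qed.

Lemma ce_setT : ce setT.
Proof.
apply/ce_semidecidable.
have dT := decidable_leq (computable_const 0) (computable_const 0).
by apply: eq_semidecidable (semidecidable_dec dT).
Qed.

Lemma ce_set0 : ce set0.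
Proof.
apply/ce_semidecidable.
have dF := decidable_leq (computable_const 1) (computable_const 0).
by apply: eq_semidecidable (semidecidable_dec dF).
Qed.

Lemma has_density_setT (R : realType) : has_density setT (1 : R).
Proof.
apply/has_densityP => e e0; exists 1%N => -[//|m] _.
suff -> : rho R setT m.+1 = 1 by rewrite subrr normr0 ltW.
rewrite rhoE /count_below (eq_bigr (fun=> 1%N)) => [|i _]; last by rewrite asboolT.
by rewrite sum1_card card_ord divff ?pnatr_eq0.
Qed.

Lemma rho_set0 (R : realType) m : rho R set0 m = 0.
Proof. by rewrite rhoE /count_below big1 ?mul0r// => i _; rewrite asboolF. Qed.

Lemma D2_dce_density (R : realType) (r : R) : 0 <= r <= 1 -> D2 r ->
  exists X : set nat, dce X /\ has_density X r.
Proof.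
(* For [r = 1] the whole of $\omega$ serves; [r < 1] makes room for a rational strictly between
   [a - 1] and [b]. *)
move=> /andP[r0]; rewrite le_eqVlt => /orP[/eqP -> _|r1 [a [b [la lb rE]]]].
  exists setT; split; last exact: has_density_setT.
  by exists setT, set0; split; [exact: ce_setT|exact: ce_set0|rewrite setD0].
have [c [d [e /andP[]]]] := @code_val_dense R (a - 1) b ltac:(lra).
(* As [b <= a], both [a - s] and [b - s] lie strictly between 0 and 1. *)
set s := code_val _ _ _ _ => sa sb.
have [A [ceA inA outA]] := ce_of_left_Pi02 c d e la.
have [B [ceB inB outB]] := ce_of_left_Pi02 c d e lb.
exists (A `\` B); split; first by exists A, B.
apply/has_densityP => eps eps0.
(* Either side of the estimate has four errors of [eps / 4]: an enlarged threshold, two position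
   counts and finitely many exceptions. *)
have e0 : 0 < eps / 4 by rewrite divr_gt0.
have [NA NAP] := outA (a + eps / 4) ltac:(lra).
have [NB NBP] := outB (b + eps / 4) ltac:(lra).
have [N1 N1P] := @rho_position_le R (a - s + eps / 4) _ ltac:(lra) e0.
have [N2 N2P] := @rho_position_ge R (b - s) _ ltac:(lra) e0.
have [N3 N3P] := @rho_position_ge R (a - s) _ ltac:(lra) e0.
have [N4 N4P] := @rho_position_le R (b - s + eps / 4) _ ltac:(lra) e0.
(* Upper bound: [B] contains all positions below [b - s], so these are disjoint from [A \ B]; from
   [NA] on, both sets lie below [a - s + eps / 4], where [b <= a] is used. *)
have [|N5 N5P] := @rho_almost_le R (A `\` B) (position_below (b - s))
    (position_below (a - s + eps / 4)) set0 NA _ e0.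
  move=> x lex; rewrite (asboolF (P := set0 x))// addn0.
  have [[Ax nBx]|nX] := EM ((A `\` B) x).
    rewrite asboolT// (asboolF (P := position_below _ _)) => [|xb].
      by rewrite asboolT//; have := NAP x lex Ax; rewrite /position_below /= -/s; lra.
    by apply/nBx/inB; move: xb; rewrite /position_below /= -/s; lra.
  rewrite (asboolF nX) add0n.
  have [xb|nxb] := EM (position_below (b - s) x); last by rewrite asboolF.
  rewrite !asboolT//; move: xb; rewrite /position_below /=; lra.
(* Lower bound: positions below [a - s] belong to [A], and those outside [A \ B] belong to [B],
   hence from [NB] on lie below [b - s + eps / 4]. *)
have [|N6 N6P] := @rho_almost_le R (position_below (a - s)) set0 (A `\` B)
    (position_below (b - s + eps / 4)) NB _ e0.
  move=> x lex; rewrite (asboolF (P := set0 x))// addn0.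
  have [xa|nxa] := EM (position_below (a - s) x); last by rewrite asboolF.
  have Ax : A x by apply: inA; move: xa; rewrite /position_below /= -/s; lra.
  rewrite (asboolT xa); have [Bx|nBx] := EM (B x); last first.
    by rewrite (asboolT (P := (A `\` B) x)).
  rewrite (asboolT (P := position_below _ _)) ?leq_addl//.
  by have := NBP x lex Bx; rewrite /position_below /= -/s; lra.
exists (maxn (maxn N1 N2) (maxn (maxn N3 N4) (maxn N5 N6))) => m.
rewrite !geq_max => /andP[/andP[/N1P h1 /N2P h2]].
move=> /andP[/andP[/N3P h3 /N4P h4] /andP[/N5P h5 /N6P h6]].
rewrite rho_set0 in h5; rewrite rho_set0 in h6.
by rewrite ler_norml; lra.
Qed.

Theorem corollary3p6 (R : realType) (r : R) :
  (exists X : set nat, dce X /\ has_density X r) <->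
  (0 <= r <= 1 /\ D2 r).
Proof.
split=> [[X [dX rX]]|[r01 D2r]]; last exact: D2_dce_density.
by split; [exact: has_density_itv rX|exact: dce_density_D2 rX].
Qed.
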